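(* For any constant $p<1$ (with $p>0$), there exists an $n$-vertex bipartite graph $G$ such that, with realization probability $p$, finding an exact minimum vertex cover or an exact maximum matching of $G_p$ with any constant probability requires querying $\Omega\!\left(\frac{n^2}{\log^2 n}\right)$ edges of $G$.
   Context: Stochastic setting: $G_p$ is the random subgraph of $G$ containing each edge independently with probability $p$. An algorithm chooses non-adaptively a set of edges of $G$ to query, learns which of them are in $G_p$, and must output a solution based only on this information (and its randomness): a vertex cover must cover all edges of $G_p$, and a matching must consist of edges of $G_p$. *)

(* Defs.v *)
From HB Require Import structures.
From mathcomp Require Import all_boot all_order all_algebra.
From mathcomp Require Import all_classical all_reals all_analysis.

Set Implicit Arguments.
Unset Strict Implicit.
Unset Printing Implicit Defensive.

Import Order.TTheory GRing.Theory Num.Theory.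

Local Open Scope ring_scope.

Record sgraph (V : finType) := SGraph {
  edges : {set {set V}};
  card_edge : forall e, e \in edges -> #|e| = 2%N
}.

Definition bipartite (V : finType) (G : sgraph V) : Prop :=
  exists A : {set V}, forall e, e \in edges G -> #|e :&: A| = 1%N.

(* In the next four definitions H is the edge set of a graph on V. *)
Definition vertex_cover (V : finType) (H : {set {set V}}) (C : {set V}) : bool :=
  [forall e in H, e :&: C != finset.set0].

Definition minimum_vertex_cover (V : finType) (H : {set {set V}})
    (C : {set V}) : bool :=
  vertex_cover H C &&
  [forall C' : {set V}, vertex_cover H C' ==> (#|C| <= #|C'|)%N].

Definition matching (V : finType) (H M : {set {set V}}) : bool :=
  (M \subset H) && finset.trivIset M.

Definition maximum_matching (V : finType) (H M : {set {set V}}) : bool :=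
  matching H M && [forall M' : {set {set V}}, matching H M' ==> (#|M'| <= #|M|)%N].

(* The law of G_p: the probability that H is exactly the set of realized
   edges, for H a subset of the edges of G. *)
Definition realization_prob (R : realType) (p : R) (V : finType) (G : sgraph V)
    (H : {set {set V}}) : R :=
  p ^+ #|H| * (1 - p) ^+ #|edges G :\: H|.

(* A randomized non-adaptive algorithm on G with random seed in T and answers
   in O. The query set depends on the seed only; [output w S] is the answer
   when the seed is w and S is the set of queried edges found to be realized.
   The last two fields say that the algorithm is measurable in the seed, its
   values lying in finite (discrete) types. *)
Record algorithm (d : measure_display) (T : measurableType d) (V : finType)
    (G : sgraph V) (O : finType) := Algorithm {
  query : T -> {set {set V}};
  output : T -> {set {set V}} -> O;
  query_sub : forall w, query w \subset edges G;
  measurable_query : forall Q, measurable [set w | query w = Q]%classic;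
  measurable_output : forall S o, measurable [set w | output w S = o]%classic
}.

Section Performance.
Context (R : realType) (d : measure_display) (T : measurableType d).
Context (P : probability T R) (V : finType) (G : sgraph V) (O : finType).
Implicit Type A : algorithm T G O.

Definition expected_queries A : \bar R :=
  'E_P[fun w => #|query A w|%:R].

(* [good H o] says that o is a correct answer when H is the set of realized
   edges. The seed is independent of G_p, so the success probability is the
   mean over the seed of the success probability at a fixed seed. *)
Definition success_prob (p : R) (good : {set {set V}} -> O -> bool) A : \bar R :=
  'E_P[fun w => \sum_(H in finset.powerset (edges G) |
                      good H (output A w (query A w :&: H)))
                  realization_prob p G H].

End Performance.

(* Main.v *)
(* In a bipartite graph with 2k core vertices, each carrying enough pendant
   leaves that it loses all of them with probability about 1/(4k), with constant
   probability exactly one core vertex on each side is left without a realized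
   leaf. Every other core vertex can be matched to (and covers the edge to) one
   of its leaves, so the matching number is decided by the single core edge
   joining the two exposed vertices. That edge is uniform among k^2 candidates,
   so an algorithm querying at most k^2/2 edges misses it with constant
   probability, and then its answer is wrong with constant probability.
   As k ~ n / log n is possible, this gives n^2 / log^2 n for one fixed success
   probability. For every constant success probability at once, the graph
   is a disjoint union of such gadgets with k = 1, 2, 4, ...: the m largest ones
   all have k^2 of order n^2 / log^2 n, and succeeding on all of them is
   exponentially unlikely in m. *)
Require Import Defs.
From HB Require Import structures.
From mathcomp Require Import all_boot all_order all_algebra.
From mathcomp Require Import zify ring lra.

Set Implicit Arguments.
Unset Strict Implicit.
Unset Printing Implicit Defensive.

Import Order.TTheory GRing.Theory Num.Theory.

Local Open Scope ring_scope.

(** * The product Bernoulli measure on the subsets of a finite set *)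

Section RandomSubset.
Variables (R : realFieldType) (p : R) (T : finType).
Implicit Types (A B E H : {set T}) (f : {set T} -> R).

Definition subset_prob E H : R := p ^+ #|H| * (1 - p) ^+ #|E :\: H|.

Definition subset_mean E f : R :=
  \sum_(H in powerset E) subset_prob E H * f H.

Lemma subset_probE E H : H \subset E ->
  subset_prob E H = \prod_(e in E) (if e \in H then p else 1 - p).
Proof.
move=> sHE; rewrite (bigID (mem H)) /=; congr (_ * _).
  rewrite (eq_bigl (fun e => e \in H)) => [|e]; last first.
    by rewrite andbC; case: (boolP (e \in H)) => // eH;
      rewrite (subsetP sHE _ eH).
  by rewrite (eq_bigr (fun=> p)) ?prodr_const // => e ->.
rewrite (eq_bigl (fun e => e \in E :\: H)) => [|e]; last by rewrite !inE andbC.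
rewrite (eq_bigr (fun=> 1 - p)) ?prodr_const // => e; rewrite inE.
by case/andP => /negPf ->.
Qed.

(** Independence across the colour classes of [c]: a subset of E amounts to a choice of one subset
    in each class, and distributivity turns the sum of products into a product of sums. *)
Lemma subset_mean_prod (J : finType) (c : T -> J) E (f : J -> {set T} -> R) :
  subset_mean E (fun H => \prod_j f j (H :&: [set e in E | c e == j])) =
  \prod_j subset_mean [set e in E | c e == j] (f j).
Proof.
set P := fun j => [set e in E | c e == j].
rewrite /subset_mean bigA_distr_big_dep /=.
pose h (H : {set T}) := [ffun j => H :&: P j].
pose h' (F : {ffun J -> {set T}}) := \bigcup_j F j.
have hK H : H \subset E -> h' (h H) = H.
  move=> sHE; apply/setP=> e; apply/bigcupP/idP => [[j _]|eH].
    by rewrite ffunE inE => /andP[].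
  by exists (c e); rewrite // ffunE !inE eH (subsetP sHE) ?eqxx.
have h'K (F : {ffun J -> {set T}}) :
    F \in family (fun j => mem (powerset (P j))) ->
    h (h' F) = F.
  move=> /familyP F_P; apply/ffunP=> j; rewrite ffunE; apply/setP=> e.
  have sF k e' : e' \in F k -> e' \in P k.
    by move: (F_P k); rewrite powersetE => /subsetP; apply.
  rewrite inE; apply/andP/idP => [[/bigcupP[k _ eFk] ePj]|eF].
    move: (sF _ _ eFk) ePj; rewrite !inE => /andP[_ /eqP ck] /andP[_ /eqP cj].
    by rewrite -cj ck.
  by split; [apply/bigcupP; exists j | apply: sF].
rewrite [RHS](reindex_onto h h') => [|F FP]; last exact: h'K.
apply: eq_big => [H|H]; rewrite powersetE.
  apply/idP/andP => [sHE|[_ /eqP <-]].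
    rewrite hK //; split => //; apply/familyP => j.
    by rewrite /h ffunE [_ \in mem _]powersetE subsetIr.
  apply/subsetP=> e /bigcupP[j _]; rewrite ffunE !inE.
  by case/andP => _ /andP[].
move=> sHE; rewrite [in RHS](eq_bigr (fun j => subset_prob (P j) (H :&: P j) *
   f j (H :&: P j))); last by move=> j _; rewrite ffunE.
rewrite big_split /=; congr (_ * _).
rewrite subset_probE // (partition_big c predT) //=.
apply: eq_bigr => j _; rewrite subset_probE ?subsetIr //.
by apply: eq_big => [e|e /andP[eE ce]]; rewrite !inE ?eE ?ce ?andbT.
Qed.

Lemma eq_subset_mean E f g :
  (forall H, H \subset E -> f H = g H) -> subset_mean E f = subset_mean E g.
Proof. by move=> fg; apply: eq_bigr => H; rewrite powersetE => /fg ->. Qed.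

Lemma subset_mean1 E : subset_mean E (fun=> 1) = 1.
Proof.
(* Colouring by the identity cuts E into classes with at most one element, where the total mass is
   computed directly. *)
transitivity (\prod_(x : T) subset_mean [set e in E | e == x] (fun=> 1)).
  rewrite -(subset_mean_prod id E (fun _ _ => 1)).
  by apply: eq_subset_mean => H _; rewrite big1.
rewrite big1 // => e _.
have [eE|eNE] := boolP (e \in E).
  have ->: [set e0 in E | e0 == e] = [set e].
    by apply/setP=> x; rewrite !inE andbC; case: eqP => // ->.
  rewrite /subset_mean powerset1 big_setU1 ?big_set1 /=; last first.
    by rewrite inE eq_sym -cards_eq0 cards1.
  rewrite /subset_prob setD0 cards0 cards1 setDv cards0 !expr0 expr1 !mulr1.
  by rewrite mul1r subrK.
have ->: [set e0 in E | e0 == e] = set0.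
  by apply/setP=> x; rewrite !inE andbC; case: eqP => // ->;
    rewrite (negPf eNE).
by rewrite /subset_mean powerset0 big_set1 /subset_prob setD0 cards0 !expr0
  !mulr1.
Qed.

Lemma subset_meanD E f g :
  subset_mean E (fun H => f H + g H) = subset_mean E f + subset_mean E g.
Proof.
by rewrite -big_split; apply: eq_bigr => H _; rewrite mulrDr.
Qed.

Lemma subset_meanZ E (a : R) f :
  subset_mean E (fun H => a * f H) = a * subset_mean E f.
Proof.
by rewrite [RHS]mulr_sumr; apply: eq_bigr => H _; rewrite mulrCA.
Qed.

Lemma subset_mean_sum (I : finType) (P : pred I) E (f : I -> {set T} -> R) :
  subset_mean E (fun H => \sum_(i | P i) f i H) =
  \sum_(i | P i) subset_mean E (f i).
Proof.
by rewrite exchange_big; apply: eq_bigr => H _; rewrite mulr_sumr.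
Qed.

Lemma subset_mean_empty E :
  subset_mean E (fun H => (H == set0)%:R) = (1 - p) ^+ #|E|.
Proof.
rewrite /subset_mean (bigD1 set0) ?powersetE ?sub0set //= eqxx mulr1.
rewrite big1 => [|H /andP[_ /negPf ->]]; last by rewrite mulr0.
by rewrite addr0 /subset_prob cards0 expr0 setD0 mul1r.
Qed.

Hypotheses (p_ge0 : 0 <= p) (p_le1 : p <= 1).

Lemma subset_prob_ge0 E H : 0 <= subset_prob E H.
Proof. by rewrite mulr_ge0 // exprn_ge0 // subr_ge0. Qed.

Lemma le_subset_mean E f g :
  (forall H, H \subset E -> f H <= g H) -> subset_mean E f <= subset_mean E g.
Proof.
move=> fg; apply: ler_sum => H; rewrite powersetE => sHE.
by rewrite ler_wpM2l ?subset_prob_ge0 ?fg.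
Qed.

(** The traces of a random set on A and off A are independent; this gives the weights of the sets
    obtained by resampling inside A. *)
Lemma subset_probU E A H B : A \subset E -> H \subset E -> B \subset A ->
  subset_prob E ((H :\: A) :|: B) =
  subset_prob A B * subset_prob (E :\: A) (H :\: A).
Proof.
move=> sAE sHE sBA.
have sUE : (H :\: A) :|: B \subset E.
  by rewrite subUset (subset_trans sBA) // (subset_trans (subsetDl _ _)).
rewrite (subset_probE sUE) (subset_probE sBA) (subset_probE (setSD A sHE)).
rewrite (bigID (mem A)) /=; congr (_ * _); apply: eq_big => [e|e].
- by rewrite andbC; case: (boolP (e \in A)) => // eA;
  rewrite (subsetP sAE _ eA).
- by case/andP=> _ eA; rewrite !inE eA.
- by rewrite !inE andbC.
- case/andP=> eE eNA; rewrite !inE eNA /=.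
  by rewrite (contraNF (subsetP sBA e)) ?orbF.
Qed.

(* Resampling the coordinates in [A H] preserves the law of H; within each
   resampling class at most one set is good, and it has conditional
   probability at most q ^+ #|A H|. *)
Lemma resampling_bound E (good : pred {set T}) (A : {set T} -> {set T})
  (q : R) :
  p <= q -> 1 - p <= q ->
  (forall H, H \subset E -> A H \subset E) ->
  (forall H B, H \subset E -> B \subset A H -> A ((H :\: A H) :|: B) = A H) ->
  (forall H H', H \subset E -> H' \subset E -> good H -> good H' ->
    A H = A H' -> H :\: A H = H' :\: A H' -> H = H') ->
  \sum_(H in powerset E | good H) subset_prob E H <=
  subset_mean E (fun H => q ^+ #|A H|).
Proof.
move=> le_pq le_p1q sAE AK inj_good.
have q_ge0 : 0 <= q by apply: le_trans le_pq.
have p1_ge0 : 0 <= 1 - p by rewrite subr_ge0.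
pose sim H H' := (A H' == A H) && (H' :\: A H' == H :\: A H).
(* The trace of H on a = [A H] has probability at most [q ^+ #|a|]. What remains is the mass off a,
   which equals the total mass of the sets agreeing with H off a; by [AK] these all lie in the class
   of H. *)
have step H : H \subset E -> subset_prob E H <=
    \sum_(H' in powerset E | sim H H') q ^+ #|A H'| * subset_prob E H'.
  move=> sHE; set a := A H; have saE : a \subset E by apply: sAE.
  have HE : H = (H :\: a) :|: (H :&: a) by rewrite setUC setID.
  rewrite {1}HE subset_probU ?subsetIr //.
  have sU B : B \subset a -> (H :\: a) :|: B \subset E.
    move=> sBa; rewrite subUset (subset_trans sBa) // andbT.
    by rewrite (subset_trans (subsetDl _ _)).
  have UD B : B \subset a -> ((H :\: a) :|: B) :\: a = H :\: a.
    move=> sBa; rewrite setDUl setDDl setUid.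
    by move: sBa; rewrite -setD_eq0 => /eqP ->; rewrite setU0.
  apply: (@le_trans _ _ (\sum_(B in powerset a)
      q ^+ #|a| * subset_prob E ((H :\: a) :|: B))); last first.
    pose S := [set (H :\: a) :|: B | B in powerset a].
    rewrite [leRHS](bigID (fun H' => H' \in S)) /=.
    rewrite ler_wpDr //.
      apply: sumr_ge0 => H' _.
      by rewrite mulr_ge0 ?subset_prob_ge0 ?exprn_ge0.
    rewrite [leRHS](eq_bigl (fun H' => H' \in S)) => [|H']; last first.
      rewrite andbC; apply/andP/idP => [[]//|H'I]; split=> //.
      case/imsetP: H'I => B; rewrite !powersetE => sBa ->.
      by rewrite sU //= /sim AK // UD // !eqxx.
    rewrite big_imset /= => [|B B']; last first.
      rewrite !powersetE => sBa sB'a /(congr1 (setI a)).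
      by rewrite !setIUr setIDA setIC -setIDA setDv setI0 !set0U
        (setIidPr sBa) (setIidPr sB'a).
    by apply: ler_sum => B; rewrite powersetE => sBa; rewrite AK.
  rewrite (eq_bigr (fun B => q ^+ #|a| * subset_prob (E :\: a) (H :\: a) *
    (subset_prob a B * 1))); last first.
    by move=> B; rewrite powersetE => sBa;
      rewrite subset_probU // mulr1 mulrCA mulrC mulrA.
  rewrite -mulr_sumr -/(subset_mean a (fun=> 1)) subset_mean1 mulr1.
  rewrite ler_wpM2r ?subset_prob_ge0 //.
  have -> : #|a| = (#|H :&: a| + #|a :\: (H :&: a)|)%N.
    by rewrite -(cardsID (H :&: a) a) (setIidPr (subsetIr _ _)).
  by rewrite exprD ler_pM ?exprn_ge0 // lerXn2r ?nnegrE.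
apply: (@le_trans _ _ (\sum_(H in powerset E | good H)
  \sum_(H' in powerset E | sim H H') q ^+ #|A H'| * subset_prob E H')).
  by apply: ler_sum => H; rewrite powersetE => /andP[sHE _]; apply: step.
(* After the exchange, each H' is charged by the good sets in its class, and [inj_good] leaves at
   most one of them. *)
rewrite (exchange_big_dep (mem (powerset E))) => [|H H' _ /andP[]//] /=.
apply: ler_sum => H'; rewrite powersetE => sH'E.
rewrite mulrC.
have [H0 /and3P[]|none] := pickP (fun H =>
  [&& H \in powerset E, good H & sim H H']); last first.
  rewrite big_pred0 ?mulr_ge0 ?subset_prob_ge0 ?exprn_ge0 // => H.
  move: (none H) => /=.
  by case: (H \in _); case: (good H); case: (sim H H'); rewrite ?andbF.
rewrite powersetE => H0E gH0 /andP[/eqP s1 /eqP s2].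
rewrite (big_pred1 H0) ?lexx // => H /=; rewrite !powersetE sH'E /=.
apply/idP/eqP => [/andP[/andP[HE gH] /andP[/eqP t1 /eqP t2]]|->].
  by apply: inj_good => //; congruence.
by rewrite H0E gH0 /sim s2 s1 !eqxx.
Qed.

End RandomSubset.

(** * Weak duality between matchings and covers, localized to components *)

Section HittingSets.
Variable V : finType.
Implicit Types (X C D : {set V}) (H M F : {set {set V}}).

(** Picking a point of D in each set of F is injective, since the sets of F are disjoint. *)
Lemma matching_le_hitting_set F D : trivIset F ->
  (forall e, e \in F -> e :&: D != set0) -> (#|F| <= #|D|)%N.
Proof.
move=> /trivIsetP trivF hit.
pose f (e : {set V}) := [pick v in e :&: D].
have fP e : e \in F -> exists2 v, f e = Some v & v \in e :&: D.
  move=> /hit; rewrite /f; case: pickP => [v vD _|none /set0Pn[v]].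
    by exists v.
  by rewrite none.
rewrite -(card_imset D (@Some_inj _)) -(@card_in_imset _ _ f (mem F)).
  apply/subset_leq_card/subsetP=> _ /imsetP[e eF ->].
  have [v -> ] := fP e eF; rewrite inE => /andP[_ vD].
  by apply/imsetP; exists v.
move=> e e' eF e'F fee'; apply/eqP; apply: contraT => /(trivF _ _ eF e'F).
have [v fe] := fP e eF; have [v' fe'] := fP e' e'F.
move: fee'; rewrite fe fe' => -[->]; rewrite !inE => /andP[v'e' _] /andP[v'e _].
by move/disjoint_setI0/setP/(_ v'); rewrite !inE v'e v'e'.
Qed.

(* A witness, local to a union X of connected components, that the matching
   number of H' exceeds the vertex cover number of H. *)
Definition local_gap H H' := exists X F D,
  [/\ forall e, e \in H -> (e \subset X) || [disjoint e & X],
      [/\ F \subset H', trivIset F & forall e, e \in F -> e \subset X],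
      D \subset X,
      forall e, e \in H -> e \subset X -> e :&: D != set0 &
      (#|D| < #|F|)%N].

(** Since M lies in H, the set D bounds the number of its edges inside X, and its other edges avoid
    X. Exchanging the edges inside X for F would give a larger matching of H'. *)
Lemma maximum_matching_local_gap H H' M : local_gap H H' ->
  maximum_matching H M -> maximum_matching H' M -> False.
Proof.
move=> [X [F [D [comp [sFH' trivF sFX] sDX hitD ltDF]]]].
move=> /andP[/andP[sMH /trivIsetP trivM] _] /andP[/andP[sMH' _] /forallP maxM].
pose MX := [set e in M | e \subset X].
have leMX : (#|MX| <= #|D|)%N.
  apply: matching_le_hitting_set => [|e]; last first.
    by rewrite inE => /andP[/(subsetP sMH) eH eX]; apply: hitD.
  by apply/trivIsetP=> e e'; rewrite !inE => /andP[eM _] /andP[e'M _];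
    apply: trivM.
have outX e : e \in M :\: MX -> [disjoint e & X].
  rewrite !inE => /andP[+ eM]; rewrite eM /= => eNX.
  by have := comp e (subsetP sMH _ eM); rewrite (negPf eNX).
have disjF e f : e \in M :\: MX -> f \in F -> [disjoint e & f].
  move=> /outX eX /sFX; move: eX; rewrite disjoint_sym => eX fX.
  by rewrite disjoint_sym (disjointWl fX).
have := maxM ((M :\: MX) :|: F); rewrite implybE => /orP[/negP[]|].
  apply/andP; split.
    by rewrite subUset sFH' andbT (subset_trans (subsetDl _ _)).
  apply/trivIsetP=> e f; rewrite !in_setU => /orP[eM|eF] /orP[fM|fF].
  - by case/setDP: eM => eM _; case/setDP: fM => fM _; apply: trivM.
  - by move=> _; apply: disjF.
  - by move=> _; rewrite disjoint_sym disjF.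
  - by move/trivIsetP: trivF; apply.
rewrite cardsU (_ : _ :&: F = set0) ?cards0 ?subn0.
  rewrite -[X in (_ <= X)%N](cardsID MX M).
  have: (#|M :&: MX| <= #|MX|)%N by rewrite subset_leq_card // subsetIr.
  lia.
apply/setP=> e; rewrite !in_setI [RHS]inE; apply/negP=> /andP[eM eF].
move: eM; rewrite !inE => /andP[+ eM]; rewrite eM /=.
by rewrite sFX.
Qed.

(** As a cover of H', C spends at least [#|F|] vertices in X; exchanging these for D would give a
    smaller cover of H. *)
Lemma minimum_vertex_cover_local_gap H H' C : local_gap H H' ->
  minimum_vertex_cover H C -> minimum_vertex_cover H' C -> False.
Proof.
move=> [X [F [D [comp [/subsetP sFH' trivF sFX] sDX hitD ltDF]]]].
move=> /andP[/forallP covH /forallP minC] /andP[/forallP covH' _].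
have leF : (#|F| <= #|C :&: X|)%N.
  apply: matching_le_hitting_set => // e eF.
  have := covH' e; rewrite sFH' //= => /set0Pn[v]; rewrite inE => /andP[ve vC].
  by apply/set0Pn; exists v; rewrite !inE ve vC (subsetP (sFX e eF)).
have := minC ((C :\: X) :|: D); rewrite implybE => /orP[/negP[]|].
  apply/forallP=> e; apply/implyP=> eH; have /orP[eX|eX] := comp e eH.
    have /set0Pn[v] := hitD e eH eX; rewrite inE => /andP[ve vD].
    by apply/set0Pn; exists v; rewrite !inE ve vD orbT.
  have := covH e; rewrite eH /= => /set0Pn[v]; rewrite inE => /andP[ve vC].
  by apply/set0Pn; exists v; rewrite !inE ve vC (disjointFr eX).
rewrite -[X in (X <= _)%N](cardsID X C).
have := (leq_card_setU (C :\: X) D).1; lia.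
Qed.

End HittingSets.

(** * Core vertices with pendant leaves, and links between cores of equal level *)

Section Gadget.
Variables (V J : finType) (lev : V -> J) (par : V -> V).
Variables (core lf : {set V}) (side : V -> bool).
Hypothesis core_lf : [disjoint core & lf].
Hypothesis par_core : forall y, y \in lf -> par y \in core.
Hypothesis lev_par : forall y, y \in lf -> lev (par y) = lev y.
Implicit Types (e : {set V}) (H Q B : {set {set V}}).

Definition linked a b :=
  [&& a \in core, b \in core, lev a == lev b, ~~ side a & side b].

Definition leaf_edges := [set [set par y; y] | y in lf].
Definition link_edges :=
  [set e | [exists a, exists b, linked a b && (e == [set a; b])]].
Definition gadget_edges := leaf_edges :|: link_edges.

Definition exposed H x :=
  [forall y in lf, (par y == x) ==> ([set par y; y] \notin H)].

(** For a link e, this is the event that each side of its level has one exposed core vertex and that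
    e joins the two. It is decided by leaf edges alone, so it reveals nothing about which links are
    realized. *)
Definition isolating H e :=
  [forall x in core, forall v in e,
    (lev x == lev v) ==> (exposed H x == (x \in e))].

(* The realization of a critical edge decides the matching number of its
   component, but is not observed by the algorithm. *)
Definition critical Q H :=
  [set e in link_edges | (e \notin Q) && isolating H e].

Lemma leaf_edgesP e :
  reflect (exists2 y, y \in lf & e = [set par y; y]) (e \in leaf_edges).
Proof. exact: imsetP. Qed.

Lemma link_edgesP e :
  reflect (exists a b, linked a b /\ e = [set a; b]) (e \in link_edges).
Proof.
rewrite inE; apply: (iffP existsP) =>
  [[a /existsP[b /andP[lab /eqP eE]]]|[a [b [lab eE]]]].
  by exists a, b.
by exists a; apply/existsP; exists b; rewrite lab eE eqxx.
Qed.

Lemma core_notin_lf v : v \in core -> v \notin lf.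
Proof. by move=> vc; rewrite (disjointFr core_lf vc). Qed.

Lemma lf_notin_core v : v \in lf -> v \notin core.
Proof. by move=> vl; rewrite (disjointFl core_lf vl). Qed.

Lemma par_neq y : y \in lf -> par y != y.
Proof.
move=> yl; apply: contraNneq (lf_notin_core yl) => <-; exact: par_core.
Qed.

Lemma linked_neq a b : linked a b -> a != b.
Proof.
by case/and5P=> _ _ _ sa sb; apply: contraNneq sa => ->.
Qed.

Lemma link_edge_core e v : e \in link_edges -> v \in e -> v \in core.
Proof.
case/link_edgesP=> a [b [/and5P[ac bc _ _ _] ->]].
by rewrite !inE => /orP[] /eqP ->.
Qed.

Lemma link_notin_leaf e : e \in link_edges -> e \notin leaf_edges.
Proof.
move=> el; apply/negP=> /leaf_edgesP[y yl eE].
have := link_edge_core el; rewrite eE => /(_ y); rewrite !inE eqxx orbT.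
by move=> /(_ isT); apply/negP/lf_notin_core.
Qed.

Lemma gadget_edge_card e : e \in gadget_edges -> #|e| = 2%N.
Proof.
rewrite in_setU => /orP[/leaf_edgesP[y yl ->]|/link_edgesP[a [b [lab ->]]]].
  by rewrite cards2 par_neq.
by rewrite cards2 linked_neq.
Qed.

Lemma gadget_bipartite : exists A : {set V},
  forall e, e \in gadget_edges -> #|e :&: A| = 1%N.
Proof.
pose A := [set v | if v \in core then side v else ~~ side (par v)].
exists A => e.
rewrite in_setU => /orP[/leaf_edgesP[y yl ->]|/link_edgesP[a [b [lab ->]]]].
  have [sy|sy] := boolP (side (par y)).
    rewrite (_ : _ :&: A = [set par y]) ?cards1 //; apply/setP=> v.
    rewrite !inE; have [->|_] /= := eqVneq v (par y); first by rewrite par_core.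
    have [->|//] /= := eqVneq v y.
    by rewrite (negPf (lf_notin_core yl)) sy.
  rewrite (_ : _ :&: A = [set y]) ?cards1 //; apply/setP=> v.
  rewrite !inE; have [->|_] /= := eqVneq v y.
    by rewrite orbT (negPf (lf_notin_core yl)) sy.
  by rewrite orbF; have [->|//] /= := eqVneq v (par y);
    rewrite par_core // (negPf sy).
case/and5P: lab => ac bc _ /negPf sa sb.
rewrite (_ : _ :&: A = [set b]) ?cards1 //; apply/setP=> v.
rewrite !inE; have [->|_] /= := eqVneq v b; first by rewrite orbT bc sb.
by rewrite orbF; have [->|//] /= := eqVneq v a; rewrite ac sa.
Qed.

Lemma gadget_edge_lev e u v : e \in gadget_edges -> u \in e -> v \in e ->
  lev u = lev v.
Proof.
rewrite in_setU => /orP[/leaf_edgesP[y yl ->]|/link_edgesP[a [b [lab ->]]]].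
  by rewrite !inE => /orP[] /eqP -> /orP[] /eqP ->; rewrite ?lev_par.
case/and5P: lab => _ _ /eqP lab _ _.
by rewrite !inE => /orP[] /eqP -> /orP[] /eqP ->; rewrite ?lab.
Qed.

Lemma eq_exposed H H' x :
  (forall y, y \in lf -> par y = x ->
     ([set par y; y] \in H) = ([set par y; y] \in H')) ->
  exposed H x = exposed H' x.
Proof.
move=> HH'; apply: eq_forallb => y; apply/implyP/implyP => h yl;
  have := h yl; by case: eqP => //= yx; rewrite HH'.
Qed.

Lemma exposedPn H x :
  reflect (exists y, [/\ y \in lf, par y = x & [set par y; y] \in H])
          (~~ exposed H x).
Proof.
rewrite negb_forall; apply: (iffP existsP) => [[y]|[y [yl yx yH]]].
  by rewrite 2!negb_imply negbK => /and3P[yl /eqP yx yH]; exists y.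
by exists y; rewrite 2!negb_imply yl negbK yH yx eqxx.
Qed.

(** Critical edges are links, whereas exposure reads leaf edges only, so resampling the former does
    not affect the latter. *)
Lemma critical_resample Q H B : B \subset critical Q H ->
  critical Q ((H :\: critical Q H) :|: B) = critical Q H.
Proof.
move=> sB.
have lkc e : e \in critical Q H -> e \in link_edges by rewrite inE => /andP[].
have ex x : exposed ((H :\: critical Q H) :|: B) x = exposed H x.
  apply: eq_exposed => y yl _.
  have yNl : [set par y; y] \notin link_edges.
    by apply/negP=> /link_notin_leaf/negP; apply; apply/leaf_edgesP; exists y.
  rewrite in_setU in_setD (contra (lkc _) yNl) /=.
  by rewrite (contraNF (subsetP sB _)) ?orbF // (contra (lkc _)).
apply/setP=> e; rewrite !inE; congr [&& _, _ & _].
apply: eq_forallb => x; congr (_ ==> _); apply: eq_forallb => v.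
by rewrite ex.
Qed.

(** Let X be the level of e and D its core vertices outside e. In H', each vertex of D keeps a leaf,
    and these leaf edges together with e form a matching of size [#|D| + 1]. In H, the set D covers
    the level: the core end of a realized leaf edge is not exposed, hence lies in D, and a link
    avoiding D has both ends in e, so it is e itself, which is absent from H. *)
Lemma critical_local_gap Q H H' e :
  H \subset gadget_edges -> H' \subset gadget_edges ->
  e \in critical Q H -> e \in critical Q H' -> e \notin H -> e \in H' ->
  local_gap H H'.
Proof.
move=> sH sH'; rewrite inE => /and3P[elk eQ /forall_inP isoH].
rewrite inE => /and3P[_ _ /forall_inP isoH'] eNH eH'.
have [a [b [lab eE]]] := link_edgesP _ elk.
have ae : a \in e by rewrite eE !inE eqxx.
pose X := [set v | lev v == lev a].
have exE x : x \in core -> x \in X ->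
    exposed H x = (x \in e) /\ exposed H' x = (x \in e).
  move=> xc; rewrite inE => lx; split.
    by have /forall_inP/(_ a ae)/implyP/(_ lx)/eqP := isoH x xc.
  by have /forall_inP/(_ a ae)/implyP/(_ lx)/eqP := isoH' x xc.
pose D := [set x in core | (x \in X) && (x \notin e)].
(* The default x is never taken on D, whose vertices are not exposed in H'. *)
pose y x := odflt x [pick y in lf | (par y == x) && ([set par y; y] \in H')].
have yP x : x \in D -> [/\ y x \in lf, par (y x) = x & [set x; y x] \in H'].
  rewrite inE => /and3P[xc xX xe].
  have [_ exH'] := exE x xc xX.
  have /exposedPn[z [zl zx zH]] : ~~ exposed H' x by rewrite exH'.
  rewrite /y; case: pickP => [t /and3P[tl /eqP tx tH]|/(_ z)] /=.
    by split; rewrite // -{1}tx.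
  by move: zH; rewrite zl zx eqxx => ->.
have lev_e v : v \in e -> lev v = lev a.
  by move=> ve; apply: (gadget_edge_lev _ ve ae); rewrite in_setU elk orbT.
have eX : e \subset X by apply/subsetP=> v /lev_e; rewrite inE => ->.
pose g x := [set x; y x].
have g_inj : {in D &, injective g}.
  move=> x x' xD x'D /setP/(_ x); rewrite !inE eqxx /= => /esym/orP[]/eqP //.
  move=> xy; have [yl _ _] := yP x' x'D.
  by move: xD (lf_notin_core yl); rewrite -xy inE => /andP[->].
have eNg : e \notin g @: D.
  apply/imsetP=> -[x]; rewrite inE => /and3P[_ _ /negP xe] eg.
  by apply: xe; rewrite eg !inE eqxx.
exists X, (e |: g @: D), D; split.
- move=> f fH; have fE := subsetP sH f fH.
  have [/existsP[v /andP[vf vX]]|] := boolP [exists v, (v \in f) && (v \in X)].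
    apply/orP; left; apply/subsetP=> u uf; move: vX.
    by rewrite !inE (gadget_edge_lev fE uf vf).
  rewrite negb_exists => /forallP no; apply/orP; right.
  by apply/pred0P=> v; apply/negbTE/no.
- split.
  + rewrite subUset sub1set eH' /=; apply/subsetP=> _ /imsetP[x xD ->].
    by case: (yP x xD).
  + have disj_e x : x \in D -> [disjoint e & g x].
      move=> xD; apply/pred0P=> v /=; apply/negP=> /andP[ve]; rewrite !inE.
      have vc := link_edge_core elk ve.
      have [yl _ _] := yP x xD.
      case/orP=> /eqP vE; last by move: (lf_notin_core yl); rewrite -vE vc.
      by move: xD; rewrite inE -vE ve !andbF.
    apply/trivIsetP=> f f'; rewrite !inE.
    move=> /orP[/eqP ->|/imsetP[x xD ->]] /orP[/eqP ->|/imsetP[x' x'D ->]].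
    * by rewrite eqxx.
    * by move=> _; apply: disj_e.
    * by move=> _; rewrite disjoint_sym disj_e.
    * move=> gxx'; have xx' : x != x' by apply: contraNneq gxx' => ->.
      have [yl yx _] := yP x xD; have [y'l y'x' _] := yP x' x'D.
      have [xc x'c] : x \in core /\ x' \in core.
        by move: xD x'D; rewrite !inE => /andP[-> _] /andP[-> _].
      apply/pred0P=> v /=; apply/negP; rewrite !inE.
      move=> /andP[/orP[]/eqP -> /orP[]]; first by apply/negP.
      - by apply/negP; apply: contraTneq xc => ->; apply: lf_notin_core.
      - by apply/negP; apply: contraTneq x'c => <-; apply: lf_notin_core.
      - apply/negP; apply: contraNneq xx' => yy.
        by rewrite -yx -y'x' yy.
  + move=> f; rewrite !inE => /orP[/eqP -> //|/imsetP[x xD ->]].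
    have [yl yx _] := yP x xD; move: xD; rewrite !inE => /and3P[_ xX _].
    by apply/subsetP=> v; rewrite !inE => /orP[]/eqP ->;
      rewrite // -(lev_par yl) yx.
- by apply/subsetP=> x; rewrite inE => /and3P[].
- move=> f fH fX; have := subsetP sH f fH.
  rewrite in_setU => /orP[/leaf_edgesP[z zl fE]|].
    apply/set0Pn; exists (par z).
    have zX : par z \in X by apply: (subsetP fX); rewrite fE !inE eqxx.
    rewrite in_setI in_set zX par_core // -(exE _ _ zX).1 ?par_core //.
    rewrite fE !inE eqxx /=.
    by apply/exposedPn; exists z; rewrite -fE.
  move=> flk; have [c [d [lcd fcd]]] := link_edgesP _ flk.
  apply: contraTneq fH => fD0.
  have in_e v : v \in f -> v \in e.
    move=> vf; apply: contraTT isT => vNe /=.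
    suff : v \in f :&: D by rewrite fD0 inE.
    by rewrite in_setI vf inE (link_edge_core flk vf) (subsetP fX).
  suff -> : f = e by [].
  apply/eqP; rewrite eqEcard; apply/andP; split; first exact/subsetP.
  by rewrite !gadget_edge_card // in_setU ?elk ?flk orbT.
by rewrite cardsU1 eNg (card_in_imset g_inj).
Qed.



Lemma critical_sub Q H : critical Q H \subset gadget_edges.
Proof.
by apply/subsetP=> e; rewrite inE in_setU => /andP[-> _]; rewrite orbT.
Qed.

(** * Success probability for a fixed query set *)

Section Success.
Variables (R : realFieldType) (p : R) (O : finType).
Variable good : {set {set V}} -> O -> bool.
Hypothesis good_gap :
  forall H H' o, local_gap H H' -> good H o -> good H' o -> False.
Hypotheses (p_ge0 : 0 <= p) (p_le1 : p <= 1).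

(** Critical edges are not queried, so realizations in one resampling class receive the same answer.
    If two of them differed, some critical edge would be present in only one, and the resulting
    local gap would forbid a common good answer. So a class has at most one good member and
    [resampling_bound] applies. *)
Lemma success_le_mean_critical (Q : {set {set V}})
    (out : {set {set V}} -> O) q :
  p <= q -> 1 - p <= q ->
  \sum_(H in powerset gadget_edges | good H (out (Q :&: H)))
     subset_prob p gadget_edges H <=
  subset_mean p gadget_edges (fun H => q ^+ #|critical Q H|).
Proof.
move=> le_pq le_p1q.
apply: (@resampling_bound R p _ p_ge0 p_le1 _
  (fun H => good H (out (Q :&: H))) (critical Q)) => //.
- by move=> H _; apply: critical_sub.
- by move=> H B _; apply: critical_resample.
suff sub H H' : H \subset gadget_edges -> H' \subset gadget_edges ->
    good H (out (Q :&: H)) -> good H' (out (Q :&: H')) ->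
    critical Q H = critical Q H' ->
    H :\: critical Q H = H' :\: critical Q H' -> H \subset H'.
  by move=> H H' *; apply/eqP; rewrite eqEsubset; apply/andP; split; apply: sub.
move=> sH sH' gH gH' cHH' /setP dHH'.
have QHH' : Q :&: H = Q :&: H'.
  apply/setP=> e; rewrite !inE; case: (boolP (e \in Q)) => //= eQ.
  have := dHH' e; rewrite !inE eQ /=.
  by rewrite !andbF.
apply/subsetP=> e eH; apply: contraT => eNH'.
have ecrit : e \in critical Q H.
  have := dHH' e; rewrite !in_setD eH (negPf eNH') andbF andbT.
  by move/negbFE.
exfalso; apply: (good_gap (H := H') (H' := H) (o := out (Q :&: H))) => //;
  last by rewrite QHH'.
by apply: (critical_local_gap (Q := Q) (e := e)) => //; rewrite -cHH'.
Qed.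

(** One scheme for the two partitions to which independence is applied: edges by level, and the
    edges of a level by the star of leaf edges containing them, with links coloured [inl tt]. *)
Definition colour (K : finType) (A : {set V}) (g : V -> K) e : unit + K :=
  if [pick v in e :&: A] is Some v then inr (g v) else inl tt.

Let edge_level := colour [set: V] lev.
Let edge_star := colour lf par.

Lemma edge_levelE e v : e \in gadget_edges -> v \in e ->
  edge_level e = inr (lev v).
Proof.
move=> eE ve; rewrite /edge_level /colour; case: pickP => [u|/(_ v)].
  by rewrite setIT => ue; rewrite (gadget_edge_lev eE ue ve).
by rewrite setIT ve.
Qed.

Lemma edge_star_leaf y : y \in lf -> edge_star [set par y; y] = inr (par y).
Proof.
move=> yl; rewrite /edge_star /colour; case: pickP => [u|/(_ y)].
  rewrite !inE => /andP[/orP[]/eqP -> //].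
  by rewrite (negPf (core_notin_lf (par_core yl))).
by rewrite !inE eqxx orbT yl.
Qed.

Lemma edge_star_link e : e \in link_edges -> edge_star e = inl tt.
Proof.
move=> el; rewrite /edge_star /colour; case: pickP => [u|//].
by rewrite inE => /andP[/(link_edge_core el) /core_notin_lf/negPf ->].
Qed.

Definition level_edges (o : unit + J) :=
  [set e in gadget_edges | edge_level e == o].

(** Whether an edge is critical depends only on leaf edges of its own level, which makes the levels
    independent. *)
Lemma critical_level Q H o :
  critical Q H :&: level_edges o =
  critical Q (H :&: level_edges o) :&: level_edges o.
Proof.
apply/setP=> e; rewrite !in_setI; case: (boolP (e \in level_edges o));
  last by rewrite !andbF.
rewrite in_set => /andP[eE /eqP eo];
  rewrite !andbT ![_ \in critical _ _]in_set; congr [&& _, _ & _].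
apply: eq_forallb => x; apply: implyb_id2l => xc.
apply: eq_forallb => v; apply: implyb_id2l => ve.
apply: implyb_id2l => /eqP xv; congr (_ == _).
apply: eq_exposed => y yl yx; rewrite in_setI.
suff -> : [set par y; y] \in level_edges o by rewrite andbT.
have fE : [set par y; y] \in gadget_edges.
  by rewrite in_setU; apply/orP; left; apply/leaf_edgesP; exists y.
by rewrite in_set fE (edge_levelE fE (set21 _ _)) yx xv -eo
  (edge_levelE eE ve) /=.
Qed.

Lemma mean_critical_levels Q q :
  subset_mean p gadget_edges (fun H => q ^+ #|critical Q H|) =
  \prod_o subset_mean p (level_edges o)
            (fun H => q ^+ #|critical Q H :&: level_edges o|).
Proof.
rewrite -(subset_mean_prod p edge_level gadget_edges
  (fun o H => q ^+ #|critical Q H :&: level_edges o|)).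
apply: eq_subset_mean => H _.
under eq_bigr => o _ do rewrite -/(level_edges o) -critical_level.
rewrite prodrXr; congr (_ ^+ _).
rewrite -sum1_card (partition_big edge_level predT) //=.
apply: eq_bigr => o _; rewrite -sum1_card; apply: eq_bigl => e.
rewrite in_setI; apply: andb_id2l => /(subsetP (critical_sub Q H)) eE.
by rewrite [in RHS]in_set eE.
Qed.

(** The ends of a critical edge are the exposed core vertices of its level, so the level determines
    the edge. *)
Lemma critical_level_le1 Q H o : (#|critical Q H :&: level_edges o| <= 1)%N.
Proof.
suff sub e e' : e \in critical Q H -> e \in level_edges o ->
    e' \in critical Q H -> e' \in level_edges o -> e \subset e'.
  apply/card_le1_eqP => e e'; rewrite ![_ \in _ :&: _]in_setI.
  move=> /andP[eC el] /andP[e'C e'l].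
  by apply/eqP; rewrite eqEsubset; apply/andP; split; apply: sub.
move=> + + + +; rewrite ![_ \in critical _ _]in_set
  ![_ \in level_edges _]in_set.
move=> /and3P[elk _ /forall_inP iso] /andP[eE /eqP eo].
move=> /and3P[e'lk _ /forall_inP iso'] /andP[e'E /eqP e'o].
have [a [b [lab e'E']]] := link_edgesP _ e'lk.
have ae' : a \in e' by rewrite e'E' !inE eqxx.
apply/subsetP=> x xe; have xc := link_edge_core elk xe.
have /forall_inP/(_ x xe)/implyP/(_ (eqxx _))/eqP ex := iso x xc.
have lxa : lev x == lev a.
  by move: eo; rewrite -e'o (edge_levelE eE xe) (edge_levelE e'E ae') => -[->].
have /forall_inP/(_ a ae')/implyP/(_ lxa)/eqP <- := iso' x xc.
by rewrite ex.
Qed.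

Lemma natr_forall (I : finType) (b : pred I) :
  ([forall i, b i])%:R = \prod_i (b i)%:R :> R.
Proof.
have [/forallP bT|] := boolP [forall i, b i].
  by rewrite big1 // => i _; rewrite bT.
rewrite negb_forall => /existsP[i /negPf bi].
by rewrite (bigD1 i) //= bi mul0r.
Qed.

Lemma bernoulli (x : R) n : 0 <= x -> x <= 1 -> 1 - n%:R * x <= (1 - x) ^+ n.
Proof.
move=> x0 x1; elim: n => [|n IH]; first by rewrite mul0r subr0 expr0.
rewrite exprS; apply: (le_trans _ (ler_wpM2l _ IH)); last by rewrite subr_ge0.
rewrite -natr1; have : 0 <= n%:R * x * x by rewrite !mulr_ge0.
lra.
Qed.

(** * A single level: the probability that it has a critical edge *)

Section Level.
Variables (j : J) (s : nat).
Let r := 1 - p.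
Let C := [set x in core | lev x == j].
Hypothesis card_leaves : forall x, x \in C -> #|[set y in lf | par y == x]| = s.

Lemma card_star x : x \in C ->
  #|[set e in level_edges (inr j) | edge_star e == inr x]| = s.
Proof.
move=> xC; rewrite -(card_leaves xC).
have -> : [set e in level_edges (inr j) | edge_star e == inr x] =
    [set [set par y; y] | y in [set y in lf | par y == x]]; last first.
  rewrite card_in_imset // => y y';
    rewrite !inE => /andP[yl /eqP yx] /andP[y'l /eqP y'x].
  move/setP/(_ y); rewrite !inE eqxx orbT => /esym/orP[]/eqP // yy.
  by move: (par_neq yl); rewrite {2}yy y'x yx eqxx.
apply/setP=> e; apply/idP/imsetP.
  rewrite in_set in_set in_setU =>
    /andP[/andP[/orP[/leaf_edgesP[y yl ->]|elk] _]].
    by rewrite edge_star_leaf // => /eqP[yx]; exists y;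
      rewrite // inE yl yx eqxx.
  by rewrite edge_star_link.
move=> [y]; rewrite inE => /andP[yl /eqP yx] ->.
rewrite in_set edge_star_leaf // yx eqxx andbT.
have fE : [set par y; y] \in gadget_edges.
  by rewrite in_setU; apply/orP; left; apply/leaf_edgesP; exists y.
rewrite -yx in_set fE (edge_levelE fE (set21 _ _)) /=.
by rewrite yx; move: xC; rewrite inE => /andP[_ /eqP ->].
Qed.

(** Isolation becomes a conjunction of one event per star, the form to which [subset_mean_prod]
    applies. *)
Lemma isolating_star H e : e \in link_edges -> e \in level_edges (inr j) ->
  H \subset level_edges (inr j) ->
  isolating H e = [forall o : unit + V,
    if o is inr x then (x \in C) ==>
      ((H :&: [set f in level_edges (inr j) | edge_star f == inr x] == set0) ==
       (x \in e))
    else true].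
Proof.
move=> elk; rewrite [e \in _]in_set => /andP[eE /eqP ej] sH.
have lev_e v : v \in e -> lev v = j.
  by move=> ve; move: ej; rewrite (edge_levelE eE ve) => -[].
have exE x : x \in C ->
    exposed H x =
    (H :&: [set f in level_edges (inr j) | edge_star f == inr x] == set0).
  move=> xC; apply/idP/eqP => [/forall_inP ex|H0].
    apply/setP=> f; rewrite in_setI in_set0; apply/negP=> /andP[fH].
    rewrite in_set in_set in_setU =>
      /andP[/andP[/orP[/leaf_edgesP[y yl fE]|flk] _]].
      rewrite fE edge_star_leaf // => /eqP[yx].
      by have := ex y yl; rewrite yx eqxx /= -yx -fE fH.
    by rewrite edge_star_link.
  apply/forall_inP=> y yl; apply/implyP=> /eqP yx; apply/negP=> fH.
  move/setP: H0 => /(_ [set par y; y]); rewrite in_setI fH in_set in_set0.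
  by rewrite edge_star_leaf // yx eqxx andbT -yx (subsetP sH).
have [a [b [lab eab]]] := link_edgesP _ elk.
have ae : a \in e by rewrite eab !inE eqxx.
apply/forall_inP/forallP => [iso [//|x]|iso x xc].
  apply/implyP=> xC; rewrite -exE //; move: xC;
    rewrite inE => /andP[xc /eqP xj].
  by have /forall_inP/(_ a ae)/implyP := iso x xc; apply; rewrite xj lev_e.
apply/forall_inP=> v ve; apply/implyP=> /eqP xv.
have xC : x \in C by rewrite inE xc xv (lev_e v ve) eqxx.
by have /implyP/(_ xC) := iso (inr x); rewrite -exE.
Qed.

(** The stars are independent: both ends of e must lose all s leaves, and each of the other
    [#|C| - 2] core vertices must keep at least one. *)
Lemma mean_isolating e : e \in link_edges -> e \in level_edges (inr j) ->
  subset_mean p (level_edges (inr j)) (fun H => (isolating H e)%:R) =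
  (r ^+ s) ^+ 2 * (1 - r ^+ s) ^+ (#|C| - 2).
Proof.
move=> elk ej.
pose F (o : unit + V) (H : {set {set V}}) : R :=
  (if o is inr x then (x \in C) ==> ((H == set0) == (x \in e)) else true)%:R.
have eC : e \subset C.
  apply/subsetP=> v ve; rewrite inE (link_edge_core elk ve) /=.
  move: ej; rewrite in_set => /andP[eE]; rewrite (edge_levelE eE ve).
  by move=> /eqP[->].
have -> : subset_mean p (level_edges (inr j)) (fun H => (isolating H e)%:R) =
    subset_mean p (level_edges (inr j)) (fun H =>
      \prod_o F o (H :&: [set f in level_edges (inr j) | edge_star f == o])).
  by apply: eq_subset_mean => H sH; rewrite isolating_star // natr_forall;
    apply: eq_bigr => -[].
rewrite subset_mean_prod big_sumType /= big1 ?mul1r => [|[] _]; last first.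
  exact: subset_mean1.
rewrite (bigID (fun x => x \in C)) /= [X in _ * X]big1 ?mulr1 => [|x xC];
  last first.
  by rewrite /F (negPf xC) subset_mean1.
rewrite (bigID (fun x => x \in e)) /=; congr (_ * _).
  rewrite (eq_bigr (fun=> r ^+ s)) => [|x /andP[xC xe]]; last first.
    rewrite /F xC xe /= -(card_star xC) -subset_mean_empty.
    by apply: eq_subset_mean => H _; rewrite eqb_id.
  rewrite prodr_const; congr (_ ^+ _).
  have eE : e \in gadget_edges by rewrite in_setU elk orbT.
  rewrite -(gadget_edge_card eE) -{2}(setIidPr eC).
  by apply: eq_card => x; rewrite unfold_in /= in_setI.
rewrite (eq_bigr (fun=> 1 - r ^+ s)) => [|x /andP[xC xe]]; last first.
  rewrite /F xC (negPf xe) /= -(card_star xC) -subset_mean_empty.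
  rewrite -[X in _ = X - _](subset_mean1 p
    [set f in level_edges (inr j) | edge_star f == inr x]).
  rewrite -mulN1r -subset_meanZ -subset_meanD; apply: eq_subset_mean => H _.
  by case: (H == set0); rewrite /= ?mulr1 ?subrr ?mulr0 ?addr0.
rewrite prodr_const; congr (_ ^+ _).
have eE : e \in gadget_edges by rewrite in_setU elk orbT.
have -> : (#|C| - 2)%N = #|C :\: e|.
  by rewrite cardsD (setIidPr eC) (gadget_edge_card eE).
by apply: eq_card => x; rewrite in_setD andbC.
Qed.

Lemma mean_critical_level_le Q q k : q <= 1 ->
  (#|C| <= 2 * k)%N -> (4 * k)%:R * r ^+ s <= 1 -> r <= (4 * k)%:R * r ^+ s ->
  (k ^ 2 <= #|link_edges :&: level_edges (inr j)|)%N -> (2 * #|Q| <= k ^ 2)%N ->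
  subset_mean p (level_edges (inr j))
    (fun H => q ^+ #|critical Q H :&: level_edges (inr j)|) <=
  1 - (1 - q) * (r ^+ 2 / 64).
Proof.
move=> q_le1 leC le_r ge_r le_link leQ.
pose S := (link_edges :&: level_edges (inr j)) :\: Q.
have r_ge0 : 0 <= r by rewrite subr_ge0.
(* With at most one critical edge, the power of q is affine in their number, and linearity of the
   mean reduces the bound to [mean_isolating]. *)
have critE H : q ^+ #|critical Q H :&: level_edges (inr j)| =
    1 + - (1 - q) * \sum_(e in S) (isolating H e)%:R.
  have -> : \sum_(e in S) (isolating H e)%:R =
      #|critical Q H :&: level_edges (inr j)|%:R :> R.
    rewrite -natr_sum; congr _%:R.
    transitivity (\sum_(e in S | isolating H e) 1)%N.
      by rewrite big_mkcondr; apply: eq_bigr => e _; case: isolating.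
    rewrite -sum1_card; apply: eq_bigl => e;
      rewrite !in_setD !in_setI ![_ \in critical _ _]in_set.
    by case: (e \in Q); case: (e \in link_edges); case: (e \in level_edges _);
      case: isolating.
  have := critical_level_le1 Q H (inr j).
  case: #|_| => [|[|//]] _; rewrite ?expr0 ?expr1; ring.
rewrite (@eq_subset_mean _ p _ _ _ (fun H => 1 + - (1 - q) *
  \sum_(e in S) (isolating H e)%:R)); last by move=> H _; apply: critE.
rewrite subset_meanD subset_mean1 subset_meanZ subset_mean_sum mulNr lerD2l lerN2.
rewrite ler_wpM2l ?subr_ge0 //.
rewrite (eq_bigr (fun=> (r ^+ s) ^+ 2 * (1 - r ^+ s) ^+ (#|C| - 2))) => [|e];
  last first.
  by rewrite !in_setD in_setI => /and3P[_ elk eL]; rewrite mean_isolating.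
rewrite sumr_const -[leRHS]mulr_natl.
have cardS : (k ^ 2 <= 2 * #|S|)%N.
  rewrite /S cardsD; set L := _ :&: level_edges _ in le_link *.
  have : (#|L :&: Q| <= #|Q|)%N by rewrite subset_leq_card // subsetIr.
  move: le_link leQ; move: #|L| #|L :&: Q| #|Q| (k ^ 2)%N; lia.
have rs_ge0 : 0 <= r ^+ s by rewrite exprn_ge0.
have rs_le1 : r ^+ s <= 1 by rewrite exprn_ile1 // lerBlDr lerDl.
(* Bernoulli's inequality, with at most 2k core vertices and [2k * r ^+ s <= 1/2]. *)
have pow_ge : 2^-1 <= (1 - r ^+ s) ^+ (#|C| - 2).
  apply: le_trans (bernoulli _ rs_ge0 rs_le1).
  have : (#|C| - 2)%:R * r ^+ s <= (2 * k)%:R * r ^+ s.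
    by rewrite ler_wpM2r // ler_nat (leq_trans (leq_subr _ _)).
  move: le_r; rewrite !natrM; lra.
have : k%:R ^+ 2 <= 2 * #|S|%:R :> R by rewrite -natrX -natrM ler_nat.
move: le_r ge_r; rewrite natrM; set x := r ^+ s in rs_ge0 rs_le1 pow_ge *.
set y := _ ^+ (_ - 2) in pow_ge *; set K := k%:R;
  set N := #|S|%:R => le_r ge_r leN.
have N_ge0 : 0 <= N :> R by rewrite ler0n.
have K_ge0 : 0 <= K :> R by rewrite ler0n.
(* At least [K ^+ 2 / 2] links are unqueried, each isolated with probability at least [x ^+ 2 / 2];
   since [r <= 4 * K * x], the product is at least [r ^+ 2 / 64]. *)
apply: (@le_trans _ _ (N * (x ^+ 2 * 2^-1))); last first.
  by rewrite ler_wpM2l // ler_wpM2l ?sqr_ge0.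
apply: (@le_trans _ _ (K ^+ 2 / 2 * (x ^+ 2 * 2^-1))); last first.
  by rewrite ler_wpM2r ?mulr_ge0 ?sqr_ge0 ?invr_ge0 // ler_pdivrMr // mulrC.
have : r ^+ 2 <= (4 * K * x) ^+ 2.
  by rewrite lerXn2r ?nnegrE ?mulr_ge0.
rewrite !exprMn; lra.
Qed.

End Level.

(** The mean factors over the levels: each level in [Js] contributes the constant of
    [mean_critical_level_le], every other factor is at most 1. *)
Lemma success_le (Q : {set {set V}}) (out : {set {set V}} -> O) q (Js : {set J})
    (s k : J -> nat) :
  p <= q -> 1 - p <= q -> q <= 1 ->
  (forall j, j \in Js ->
    [/\ forall x, x \in core -> lev x = j ->
          #|[set y in lf | par y == x]| = s j,
        (#|[set x in core | lev x == j]| <= 2 * k j)%N,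
        (4 * k j)%:R * (1 - p) ^+ s j <= 1 <=
          (4 * k j)%:R * (1 - p) ^+ s j / (1 - p),
        (k j ^ 2 <= #|link_edges :&: level_edges (inr j)|)%N &
        (2 * #|Q| <= k j ^ 2)%N]) ->
  p < 1 ->
  \sum_(H in powerset gadget_edges | good H (out (Q :&: H)))
     subset_prob p gadget_edges H <=
  (1 - (1 - q) * ((1 - p) ^+ 2 / 64)) ^+ #|Js|.
Proof.
move=> le_pq le_p1q q_le1 Jgood p_lt1.
have q_ge0 : 0 <= q by apply: le_trans le_pq.
apply: le_trans (success_le_mean_critical Q out le_pq le_p1q) _.
rewrite mean_critical_levels big_sumType /=.
have mean_ge0 o : 0 <= subset_mean p (level_edges o)
    (fun H => q ^+ #|critical Q H :&: level_edges o|).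
  by apply: sumr_ge0 => H _; rewrite mulr_ge0 ?subset_prob_ge0 ?exprn_ge0.
have mean_le1 o : subset_mean p (level_edges o)
    (fun H => q ^+ #|critical Q H :&: level_edges o|) <= 1.
  rewrite -[leRHS](subset_mean1 p (level_edges o)).
  by apply: le_subset_mean => // H _; rewrite exprn_ile1.
rewrite (bigID (fun j => j \in Js)) /= mulrCA.
apply: (@le_trans _ _ (\prod_(j in Js) subset_mean p (level_edges (inr j))
    (fun H => q ^+ #|critical Q H :&: level_edges (inr j)|))).
  rewrite ler_piMr ?prodr_ge0 // mulr_ile1 ?prodr_ge0 ?prodr_ile1 // => i *;
    by rewrite mean_ge0 mean_le1.
rewrite -prodr_const; apply: ler_prod => j jJ; rewrite mean_ge0 /=.
have [leaves leC /andP[le_r ge_r] le_link leQ] := Jgood j jJ.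
apply: (@mean_critical_level_le j (s j) _ Q q (k j)) => //.
  by move=> x; rewrite inE => /andP[xc /eqP xj]; apply: leaves.
by move: ge_r; rewrite ler_pdivlMr ?subr_gt0 // mul1r.
Qed.


End Success.

End Gadget.

(** * A concrete graph on ['I_n] with levels of dyadic size *)

(* The vertices u * w, ..., u * w + w - 1 carry the core vertex u * w and its
   leaves; level i consists of the cores with 2 ^ i <= u < 2 ^ i.+1. *)
Section DyadicGraph.
Variables (n w : nat) (ell : nat -> nat).
Hypothesis w_gt0 : (0 < w)%N.

Definition dyadic_level (v : 'I_n) : 'I_n.+1 := inord (trunc_log 2 (v %/ w)).

Definition dyadic_par (v : 'I_n) : 'I_n :=
  Ordinal (leq_ltn_trans (leq_trunc_div v w) (ltn_ord v)).

Definition dyadic_core : {set 'I_n} := [set v : 'I_n | v %% w == 0]%N.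

(** Larger offsets are left as isolated vertices, so the number of leaves can vary with the level
    while all blocks have width [w]. *)
Definition dyadic_leaves : {set 'I_n} :=
  [set v : 'I_n | 0 < v %% w <= ell (trunc_log 2 (v %/ w))]%N.

(** Parity halves the [2 ^ i] consecutive blocks of a complete level with i positive. *)
Definition dyadic_side (v : 'I_n) := odd (v %/ w).

Lemma trunc_log2_le m : (trunc_log 2 m <= m)%N.
Proof.
case: (posnP m) => [->//|m0]; apply: leq_trans (@trunc_logP 2 _ isT m0).
by apply/ltnW/ltn_expl.
Qed.

Lemma dyadic_levelE v : dyadic_level v = trunc_log 2 (v %/ w) :> nat.
Proof.
rewrite inordK // ltnS (leq_trans (trunc_log2_le _)) // (leq_trans
  (leq_div _ _)) //.
exact/ltnW/ltn_ord.
Qed.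

Lemma dyadic_core_leaves : [disjoint dyadic_core & dyadic_leaves].
Proof. by apply/pred0P=> v /=; rewrite !inE; case: eqP => // ->. Qed.

Lemma dyadic_par_core y : y \in dyadic_leaves -> dyadic_par y \in dyadic_core.
Proof. by move=> _; rewrite inE /= modnMl. Qed.

Lemma dyadic_level_par y : y \in dyadic_leaves ->
  dyadic_level (dyadic_par y) = dyadic_level y.
Proof. by move=> _; rewrite /dyadic_level /= mulnK. Qed.

Definition dyadic_edges :=
  gadget_edges dyadic_level dyadic_par dyadic_core dyadic_leaves dyadic_side.

Definition dyadic_graph : sgraph 'I_n :=
  SGraph (gadget_edge_card dyadic_core_leaves dyadic_par_core :
    forall e, e \in dyadic_edges -> #|e| = 2%N).

Lemma dyadic_bipartite : bipartite dyadic_graph.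
Proof. exact: (gadget_bipartite _ _ dyadic_core_leaves dyadic_par_core). Qed.

(** * Counting cores, leaves and links in a complete level *)

Section Counting.
Variable i : nat.
Hypotheses (i_gt0 : (0 < i)%N) (le_n : (2 ^ i.+1 * w <= n)%N).
Hypothesis lt_ell : (ell i < w)%N.
Let j : 'I_n.+1 := inord i.

Lemma level_index : j = i :> nat.
Proof.
rewrite inordK // ltnS; apply: leq_trans le_n; apply: (@leq_trans (2 ^ i.+1)).
  by apply/ltnW/(leq_trans (leqnSn _))/ltn_expl.
by rewrite leq_pmulr.
Qed.

Lemma dyadic_level_eq v : (dyadic_level v == j) =
  (2 ^ i <= v %/ w < 2 ^ i.+1)%N.
Proof.
rewrite -val_eqE /= dyadic_levelE level_index.
apply/eqP/idP => [Ei|]; last exact: trunc_log_eq.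
rewrite -Ei; apply: trunc_log_bounds => //.
(* Block 0 also gets level 0, because [trunc_log 2 0 = 0]; a positive i excludes it. *)
by case: posnP => // v0; move: i_gt0; rewrite -Ei v0 trunc_log0.
Qed.

Lemma core_val x : x \in dyadic_core -> (x %/ w * w = x)%N.
Proof. by rewrite inE => /eqP xw; rewrite [RHS](divn_eq x w) xw addn0. Qed.

Lemma ltn_core_leaf u t : (u < 2 ^ i.+1)%N -> (t < w)%N -> (u * w + t < n)%N.
Proof.
move=> lu lt; apply: leq_trans le_n; apply: (@leq_trans (u.+1 * w)).
  by rewrite mulSn addnC ltn_add2r.
by rewrite leq_mul2r lu orbT.
Qed.

Lemma card_dyadic_leaves x : x \in dyadic_core -> dyadic_level x = j ->
  #|[set y in dyadic_leaves | dyadic_par y == x]| = ell i.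
Proof.
move=> xc /eqP; rewrite dyadic_level_eq => /andP[lex ltx].
have xE := core_val xc.
have ell_w (t : 'I_(ell i)) : (t.+1 < w)%N by apply: leq_ltn_trans lt_ell;
  exact: ltn_ord.
(* Offset 0 is the core vertex itself, so leaf number t sits at offset [t.+1]. *)
pose f (t : 'I_(ell i)) : 'I_n := Ordinal (ltn_core_leaf ltx (ell_w t)).
have -> : [set y in dyadic_leaves | dyadic_par y == x]
  = [set f t | t in 'I_(ell i)].
  apply/setP=> y; apply/idP/imsetP => [|[t _ ->]].
    rewrite !inE -val_eqE /= => /andP[/andP[y0 yell] /eqP yx].
    have yd : (y %/ w = x %/ w)%N by rewrite -yx mulnK.
    have yi : trunc_log 2 (y %/ w) = i by rewrite yd;
      apply: trunc_log_eq => //; apply/andP.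
    rewrite yi in yell.
    have yt : ((y %% w).-1 < ell i)%N by case: (y %% w)%N y0 yell.
    exists (Ordinal yt) => //; apply/val_inj; rewrite /= prednK //.
    by rewrite [LHS](divn_eq y w) yd.
  rewrite !inE -val_eqE /= divnMDl // modnMDl (divn_small (ell_w t)) addn0.
  rewrite (modn_small (ell_w t)) xE eqxx andbT /=.
  by rewrite (trunc_log_eq (n := i)) ?ltn_ord //; apply/andP.
rewrite card_imset ?card_ord // => t t' /(congr1 val) /= /addnI [].
exact: val_inj.
Qed.

Lemma card_dyadic_core :
  (#|[set x in dyadic_core | dyadic_level x == j]| <= 2 ^ i)%N.
Proof.
set C := [set x in _ | _].
rewrite cardE -(size_map (@nat_of_ord n)) -(size_iota 0 (2 ^ i)).
rewrite -(size_map (fun t => (2 ^ i + t) * w)%N (iota _ _));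
  apply: uniq_leq_size.
  by rewrite (map_inj_uniq (@ord_inj n)) enum_uniq.
move=> _ /mapP[x + ->]; rewrite mem_enum inE => /andP[xc].
rewrite dyadic_level_eq expnS => /andP[lex ltx].
apply/mapP; exists (x %/ w - 2 ^ i)%N; first by rewrite mem_iota; lia.
by rewrite subnKC // core_val.
Qed.

Lemma card_dyadic_links :
  ((2 ^ i.-1) ^ 2 <=
   #|link_edges dyadic_level dyadic_core dyadic_side :&:
     level_edges dyadic_level dyadic_par dyadic_core dyadic_leaves dyadic_side
       (inr j)|)%N.
Proof.
set k := (2 ^ i.-1)%N.
have iE : (2 ^ i = 2 * k)%N by rewrite -expnS prednK.
(* As [2 ^ i] is even, the blocks [2 ^ i + (a.*2 + b)] with a < k lie in level i and have parity b;
   pairs of opposite parity give the [k ^ 2] links. *)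
have ltA (b : bool) (a : 'I_k) : ((2 ^ i + (a.*2 + b)) * w < n)%N.
  rewrite -[X in (X < _)%N]addn0; apply: ltn_core_leaf => //.
  by have := ltn_ord a; rewrite expnS iE; case: b; lia.
pose A b a : 'I_n := Ordinal (ltA b a).
have A_core b a : A b a \in dyadic_core by rewrite inE /= modnMl.
have A_level b a : dyadic_level (A b a) = j.
  apply/eqP; rewrite dyadic_level_eq /= mulnK // expnS iE.
  by have := ltn_ord a; case: b; lia.
have A_side b a : dyadic_side (A b a) = b.
  by rewrite /dyadic_side /= mulnK // !oddD odd_double iE oddM /=; case: b.
have A_inj b : injective (A b).
  move=> a a' /(congr1 val) /= /eqP; rewrite eqn_pmul2r // eqn_add2l eqn_add2r.
  by move=> /eqP/double_inj/val_inj.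
pose f (ab : 'I_k * 'I_k) := [set A false ab.1; A true ab.2].
have -> : (k ^ 2 = #|[set f ab | ab in [set: 'I_k * 'I_k]]|)%N.
  rewrite card_imset ?cardsT ?card_prod ?card_ord ?mulnn // => -[a b] [a' b'].
  rewrite /f /= => /setP fE.
  have := fE (A false a); rewrite !inE eqxx /= =>
    /esym/orP[/eqP/A_inj ->|/eqP E]; last first.
    by have := A_side false a; rewrite E A_side.
  have := fE (A true b); rewrite !inE eqxx orbT /= =>
    /esym/orP[/eqP E|/eqP/A_inj -> //].
  by have := A_side true b; rewrite E A_side.
apply/subset_leq_card/subsetP => _ /imsetP[[a b] _ ->].
have lk : f (a, b) \in link_edges dyadic_level dyadic_core dyadic_side.
  apply/link_edgesP; exists (A false a), (A true b); split=> //.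
  by rewrite /linked !A_core !A_side !A_level eqxx.
have fE : f (a, b) \in dyadic_edges by rewrite in_setU lk orbT.
rewrite in_setI lk in_set fE /=.
have Af : A false a \in f (a, b) by rewrite !inE eqxx.
by rewrite (edge_levelE dyadic_level_par fE Af) A_level.
Qed.

End Counting.
End DyadicGraph.
From mathcomp Require Import all_classical all_reals all_analysis.
From mathcomp Require Import measurable_realfun.

(** * Measurability of maps that factor through finite types *)

Section FiniteValued.
Variables (d : measure_display) (T : measurableType d).

Lemma measurable_fiber_pair (F F' : finType) (f : T -> F) (g : T -> F') :
  (forall a, measurable [set w | f w = a]%classic) ->
  (forall b, measurable [set w | g w = b]%classic) ->
  forall ab, measurable [set w | (f w, g w) = ab]%classic.
Proof.
move=> mf mg [a b].
have -> : [set w | (f w, g w) = (a, b)]%classic =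
    ([set w | f w = a] `&` [set w | g w = b])%classic.
  by apply/seteqP; split=> w /= => [[-> ->]|[-> ->]].
exact: measurableI.
Qed.

Lemma measurable_fiber_ffun (F F' : finType) (f : T -> F -> F') :
  (forall a b, measurable [set w | f w a = b]%classic) ->
  forall h, measurable [set w | [ffun a => f w a] = h]%classic.
Proof.
move=> mf h.
have -> : [set w | [ffun a => f w a] = h]%classic =
    (\bigcap_(a in [set: F]) [set w | f w a = h a])%classic.
  apply/seteqP; split=> w /= => [<- a _ /=|fh]; first by rewrite ffunE.
  by apply/ffunP => a; rewrite ffunE fh.
by apply: fin_bigcap_measurable => // a _; exact: mf.
Qed.

Lemma measurable_fun_fiber (R : realType) (F : finType)
    (f : T -> F) (g : F -> R) :
  (forall a, measurable [set w | f w = a]%classic) ->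
  measurable_fun [set: T]%classic (g \o f).
Proof.
move=> mf _ Y _; rewrite setTI.
have -> : ((g \o f) @^-1` Y)%classic =
    (\bigcup_(a in [set a | Y (g a)]) [set w | f w = a])%classic.
  by apply/seteqP; split=> w /= => [Yw|[a Ya ->//]]; exists (f w).
by apply: fin_bigcup_measurable => // a _; exact: mf.
Qed.

End FiniteValued.

(** * From success at a fixed seed to the expected number of queries *)

Section Queries.
Variables (R : realType) (d : measure_display) (T : measurableType d).
Variables (P : probability T R) (V : finType) (G : sgraph V) (O : finType).
Variables (p : R) (good : {set {set V}} -> O -> bool) (A : algorithm T G O).
Hypotheses (p_ge0 : 0 <= p) (p_le1 : p <= 1).

Let success w : R := \sum_(H in powerset (edges G) |
  good H (output A w (query A w :&: H))) realization_prob p G H.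

Lemma success_ge0 w : 0 <= success w.
Proof.
by apply: sumr_ge0 => H _; rewrite mulr_ge0 ?exprn_ge0 ?subr_ge0.
Qed.

Lemma measurable_success : measurable_fun [set: T]%classic success.
Proof.
(* The seed matters only through the query set and the finite table of answers. *)
pose g (qo : {set {set V}} * {ffun {set {set V}} -> O}) : R :=
  \sum_(H in powerset (edges G) | good H (qo.2 (qo.1 :&: H)))
    realization_prob p G H.
rewrite (_ : success = g \o (fun w => (query A w, [ffun S => output A w S]))).
  apply: measurable_fun_fiber; apply: measurable_fiber_pair.
    exact: measurable_query.
  by apply: measurable_fiber_ffun => S o; exact: measurable_output.
by apply/funext => w; apply: eq_bigl => H; rewrite /= ffunE.
Qed.

Lemma measurable_card_query :
  measurable_fun [set: T]%classic (fun w => #|query A w|%:R : R).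
Proof.
exact: (measurable_fun_fiber (fun Q : {set {set V}} => #|Q|%:R)
  (measurable_query A)).
Qed.

(** Integrating the pointwise bound over the seed leaves [delta / 2] to be paid for by the expected
    queries divided by [tau]. *)
Lemma expected_queries_ge (delta tau : R) : 0 < delta -> 0 < tau ->
  (forall w, success w <= delta / 2 + tau^-1 * #|query A w|%:R) ->
  (delta%:E <= success_prob P p good A)%E ->
  ((delta / 2 * tau)%:E <= expected_queries P A)%E.
Proof.
move=> delta_gt0 tau_gt0 le_succ /le_trans le_delta.
have /le_delta : (success_prob P p good A <=
    (delta / 2)%:E + (tau^-1)%:E * expected_queries P A)%E.
  rewrite /success_prob /expected_queries unlock.
  have mQ : measurable_fun [set: T]%classic
      (fun w => (#|query A w|%:R)%:E : \bar R).
    exact/measurable_EFinP/measurable_card_query.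
  have Q_ge0 w : (0 <= (#|query A w|%:R)%:E :> \bar R)%E by rewrite lee_fin.
  have tau_ge0 : (0 <= (tau^-1)%:E)%E by rewrite lee_fin invr_ge0 ltW.
  have delta_ge0 : (0 <= (delta / 2)%:E)%E by rewrite lee_fin ltW // divr_gt0.
  rewrite -(ge0_integralZl _ measurableT mQ (fun w _ => Q_ge0 w) tau_ge0).
  have mtQ := measurable_funeM (tau^-1)%:E mQ.
  rewrite -[X in (X + _)%E]mule1 -(probability_setT P) -integral_cst //.
  rewrite -ge0_integralD //=; last by move=> w _; apply: mule_ge0.
  apply: ge0_le_integral => //.
  - by move=> w _; rewrite lee_fin success_ge0.
  - exact/measurable_EFinP/measurable_success.
  - exact: emeasurable_funD.
  - by move=> w _; rewrite -EFinM -EFinD lee_fin; apply: le_succ.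
case: (expected_queries P A) => [x||].
- rewrite -EFinM -EFinD !lee_fin => le.
  rewrite -ler_pdivlMr // mulrC; lra.
- by rewrite leey.
- by rewrite gt0_muleNy ?lte_fin ?invr_gt0.
Qed.

End Queries.

(** * The number of leaves per core vertex *)

Section LeafNumber.
Variables (R : realType) (r : R).
Hypotheses (r_gt0 : 0 < r) (r_lt1 : r < 1).

(* The least s such that y * r ^+ s < 1. *)
Definition leaf_number (y : R) : nat := (Num.trunc (ln y / ln r^-1)).+1.

Lemma ln_inv_gt0 : 0 < ln r^-1.
Proof. by rewrite ln_gt0 // invf_gt1. Qed.

Lemma leaf_number_le y z : 0 < y -> y <= z ->
  (leaf_number y <= leaf_number z)%N.
Proof.
move=> y0 yz; rewrite ltnS; apply: le_truncn.
by rewrite ler_pM2r ?invr_gt0 ?ln_inv_gt0 // ler_ln ?posrE // (lt_le_trans y0).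
Qed.

Lemma leaf_number_bound y : 1 <= y -> (leaf_number y)%:R <= ln y / ln r^-1 + 1.
Proof.
move=> y1; rewrite /leaf_number -natr1 lerD2r truncn_le.
by apply: divr_ge0; [exact: ln_ge0 | exact: ltW ln_inv_gt0].
Qed.

(** After taking logarithms, these are the two inequalities defining the truncation. They place
    [y * r ^+ s] between r and 1. *)
Lemma leaf_number_power y : 1 <= y ->
  y * r ^+ leaf_number y <= 1 <= y * r ^+ leaf_number y / r.
Proof.
move=> y1; have y0 : 0 < y by apply: lt_le_trans y1.
have /andP[le_t lt_t] : (Num.trunc (ln y / ln r^-1))%:R <= ln y / ln r^-1
    < (Num.trunc (ln y / ln r^-1)).+1%:R.
  by apply/truncn_itv/divr_ge0; [exact: ln_ge0 | exact: ltW ln_inv_gt0].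
have lnE m : ln (y * r ^+ m) = ln y - m%:R * ln r^-1.
  by rewrite lnM ?posrE ?exprn_gt0 // lnXn // lnV
    ?posrE // mulrN opprK mulr_natl.
have pos m : 0 < y * r ^+ m by rewrite mulr_gt0 ?exprn_gt0.
apply/andP; split.
  rewrite -ler_ln ?posrE // ln1 lnE subr_le0.
  by rewrite -ler_pdivrMr ?ln_inv_gt0 // ltW.
rewrite exprSr mulrA mulfK ?gt_eqF //.
rewrite -ler_ln ?posrE // ln1 lnE subr_ge0.
by rewrite -ler_pdivlMr ?ln_inv_gt0.
Qed.

End LeafNumber.

Lemma expr_small (R : realType) (x e : R) : 0 <= x -> x < 1 -> 0 < e ->
  exists m, x ^+ m <= e.
Proof.
move=> x0 x1 e0.
have /cvg_expr/cvgrPdist_le/(_ e e0)[m _ /(_ m (leqnn m))] :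
    `|x| < 1 by rewrite ger0_norm.
by rewrite /= sub0r normrN ger0_norm ?exprn_ge0 //; exists m.
Qed.

(** * Success on the dyadic graph with few queries *)

Section DyadicSuccess.
Variables (R : realType) (p : R) (O : finType) (n w : nat) (ell : nat -> nat).
Hypotheses (p_gt0 : 0 < p) (p_lt1 : p < 1) (w_gt0 : (0 < w)%N).
Variable good : {set {set 'I_n}} -> O -> bool.
Hypothesis good_gap :
  forall H H' o, local_gap H H' -> good H o -> good H' o -> False.

(** Levels below t are complete, and [success_le] is applied to the top m of them, t - m, ..., t -
    1, with [k = 2 ^ i.-1] at level i. The smallest of these k is [2 ^ (t - m).-1], so the bound on
    [#|Q|] serves all m levels; [m < t] keeps their indices positive. *)
Lemma dyadic_success_le (Q : {set {set 'I_n}})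
    (out : {set {set 'I_n}} -> O) t m :
  (m < t)%N -> (2 ^ t * w <= n)%N ->
  (forall i, (i < t)%N -> (ell i < w)%N /\
     (2 ^ i.+1)%:R * (1 - p) ^+ ell i <= 1 <=
     (2 ^ i.+1)%:R * (1 - p) ^+ ell i / (1 - p)) ->
  (2 * #|Q| <= (2 ^ (t - m).-1) ^ 2)%N ->
  \sum_(H in powerset (edges (dyadic_graph n w ell)) | good H (out (Q :&: H)))
    realization_prob p (dyadic_graph n w ell) H <=
  (1 - (1 - Num.max p (1 - p)) * ((1 - p) ^+ 2 / 64)) ^+ m.
Proof.
move=> lt_mt le_n ellP leQ.
have lt_tn : (t < n)%N.
  apply: (leq_trans (@ltn_expl 2 t isT)); apply: leq_trans le_n.
  by rewrite leq_pmulr.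
pose lv (a : 'I_m) : 'I_n.+1 := inord (t - m + a).
have lvE a : lv a = (t - m + a)%N :> nat.
  by rewrite inordK //; have := ltn_ord a; lia.
pose Js : {set 'I_n.+1} := [set lv a | a in 'I_m].
have cardJs : #|Js| = m.
  rewrite card_imset ?card_ord // => a b /(congr1 val) /=; rewrite !lvE.
  by move/addnI/val_inj.
rewrite -[X in _ ^+ X]cardJs.
apply: (@success_le _ _ _ _ _ _ _ (dyadic_core_leaves n w ell)
  (@dyadic_par_core n w ell) (@dyadic_level_par n w ell w_gt0) R p O good
  good_gap (ltW p_gt0) (ltW p_lt1) Q out _ Js
  (fun j : 'I_n.+1 => ell j) (fun j : 'I_n.+1 => (2 ^ j.-1)%N)) => //.
- by rewrite le_max lexx.
- by rewrite le_max lexx orbT.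
- by rewrite ge_max ltW //= lerBlDr lerDl ltW.
move=> _ /imsetP[a _ ->]; rewrite lvE; set i := (t - m + a)%N.
have lt_it : (i < t)%N by have := ltn_ord a; rewrite /i; lia.
have i_gt0 : (0 < i)%N by rewrite /i; lia.
have [lt_ell powP] := ellP i lt_it.
have le_in : (2 ^ i.+1 * w <= n)%N.
  by apply: leq_trans le_n; rewrite leq_mul2r leq_exp2l ?lt_it ?orbT.
have iE : (2 * 2 ^ i.-1 = 2 ^ i)%N by rewrite -expnS prednK.
have lv_i : lv a = inord i by [].
split.
- by move=> x xc; rewrite lv_i;
  exact: (card_dyadic_leaves w_gt0 i_gt0 le_in lt_ell xc).
- by rewrite iE; exact: (card_dyadic_core w_gt0 i_gt0 le_in lt_ell).
- by rewrite (_ : 4 * 2 ^ i.-1 = 2 ^ i.+1)%N // expnS -iE mulnA.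
- exact: (card_dyadic_links w_gt0 i_gt0 le_in lt_ell).
- apply: leq_trans leQ _; rewrite leq_exp2r // leq_exp2l // /i; lia.
Qed.

End DyadicSuccess.

(** * The hard graph and the lower bound on queries *)

Definition hard_graph (R : realType) (p : R) (n : nat) : sgraph 'I_n :=
  dyadic_graph n (leaf_number (1 - p) n%:R).+1
    (fun i => leaf_number (1 - p) (2 ^ i.+1)%:R).

Lemma expn_split b t m : (m < t)%N ->
  (b ^ t.+1 = b ^ (t - m).-1 * b ^ m.+2)%N.
Proof.
by move=> lt_mt; rewrite -expnD; congr (_ ^ _)%N; lia.
Qed.

(** Keeping [good] abstract treats covers and matchings at once. A seed with at most [K ^ 2 / 2]
    queries succeeds with probability at most [delta / 2], and K is at least of order n / ln n. *)
Lemma hard_graph_queries (R : realType) (p delta : R) :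
  0 < p -> p < 1 -> 0 < delta ->
  exists c : R, 0 < c /\ exists N : nat, forall n : nat, (N <= n)%N ->
  forall (d : measure_display) (T : measurableType d) (P : probability T R)
    (O : finType) (good : {set {set 'I_n}} -> O -> bool),
  (forall H H' o, local_gap H H' -> good H o -> good H' o -> False) ->
  forall A : algorithm T (hard_graph p n) O,
    (delta%:E <= success_prob P p good A)%E ->
    ((c * (n%:R ^+ 2 / ln n%:R ^+ 2))%:E <= expected_queries P A)%E.
Proof.
move=> p_gt0 p_lt1 delta_gt0; set r := 1 - p.
have r_gt0 : 0 < r by rewrite subr_gt0.
have r_lt1 : r < 1 by rewrite ltrBlDr ltrDl.
set q := Num.max p r; have q_lt1 : q < 1 by rewrite gt_max p_lt1.
have q_ge0 : 0 <= q by rewrite le_max ltW.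
have r2_gt0 : 0 < r ^+ 2 by rewrite exprn_gt0.
have r2_le1 : r ^+ 2 <= 1 by rewrite exprn_ile1 // ltW.
have [m le_m] : exists m, (1 - (1 - q) * (r ^+ 2 / 64)) ^+ m <= delta / 2.
  apply: expr_small; [nra | nra | by rewrite divr_gt0].
have L_gt0 := ln_inv_gt0 r_gt0 r_lt1.
(* Chosen so that [w <= C * ln n]: the 2 absorbs the two successors in w once [ln n >= 1]. *)
set C : R := (ln r^-1)^-1 + 2.
have C_gt0 : 0 < C by rewrite addr_gt0 // invr_gt0.
(* Chosen so that n < [2 ^ t.+1 * w] = [K * 2 ^ m.+2 * w] yields [n <= K * (B * ln n)]. *)
pose B : R := 2 ^+ m.+2 * C.
have B_gt0 : 0 < B by rewrite mulr_gt0 // exprn_gt0.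
exists (delta / 2 * (B ^- 2 / 2)); split.
  by rewrite mulr_gt0 ?divr_gt0 // invr_gt0 exprn_gt0.
(* [n >= B ^+ 2] together with [ln n <= 2 * sqrt n] gives [2 ^ m.+1 * w <= n], hence [m < t]; n at
   least e gives [ln n >= 1]. *)
exists (maxn (Num.trunc (B ^+ 2)).+1 (Num.trunc (expR 1 : R)).+1) => n.
rewrite geq_max => /andP[le_Bn le_en] d T P O good good_gap A.
set x : R := n%:R.
have B_x : B ^+ 2 <= x.
  by apply: le_trans (ltW (truncnS_gt _)) _; rewrite ler_nat.
have e_x : expR 1 <= x.
  by apply: le_trans (ltW (truncnS_gt _)) _; rewrite ler_nat.
have x_gt0 : 0 < x by apply: lt_le_trans (expR_gt0 1) e_x.
have lnx_ge1 : 1 <= ln x by rewrite -[leLHS]expRK ler_ln ?posrE ?expR_gt0.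
have x_ge1 : 1 <= x by apply: le_trans e_x; rewrite ltW // expR_gt1.
have lnx_gt0 : 0 < ln x by apply: lt_le_trans lnx_ge1.
set w := (leaf_number r x).+1.
have w_ln : w%:R <= C * ln x.
  rewrite -natr1; have := leaf_number_bound r_gt0 r_lt1 x_ge1.
  rewrite /C mulrDl [_^-1 * _]mulrC; lra.
have Bw : 2 ^+ m.+2 * w%:R <= B * ln x.
  by rewrite /B -mulrA ler_wpM2l // exprn_ge0.
have le_wn : (2 ^ m.+1 * w <= n)%N.
  rewrite -(ler_nat R) natrM natrX -/x.
  have := sqr_sqrtr (ltW x_gt0); have s_ge0 := sqrtr_ge0 x.
  have B_s : B <= Num.sqrt x.
    by rewrite -(ger0_norm (ltW B_gt0)) -sqrtr_sqr ler_wsqrtr.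
  have s_gt0 : 0 < Num.sqrt x by apply: lt_le_trans B_s.
  have ln_s : ln x <= 2 * Num.sqrt x.
    rewrite -{1}(sqr_sqrtr (ltW x_gt0)) lnXn // -[leLHS]mulr_natl ler_pM2l //.
    exact/ltW/ln_sublinear.
  move: Bw; rewrite [2 ^+ m.+2]exprS.
  have : B * ln x <= 2 * (Num.sqrt x * Num.sqrt x).
    by rewrite mulrCA ler_pM // ltW.
  rewrite expr2; lra.
have N0_gt0 : (0 < n %/ w)%N.
  by rewrite divn_gt0 // (leq_trans _ le_wn) // leq_pmull // expn_gt0.
set t := trunc_log 2 (n %/ w).
have lt_mt : (m < t)%N by apply: trunc_log_max; rewrite // leq_divRL.
have le_tn : (2 ^ t * w <= n)%N by rewrite -leq_divRL // trunc_logP.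
have lt_nt : (n < 2 ^ t.+1 * w)%N by rewrite -ltn_divLR // trunc_log_ltn.
clearbody t; pose K := (2 ^ (t - m).-1)%N.
have K_gt0 : (0 < K)%N by rewrite expn_gt0.
have KE : (2 ^ t.+1 = K * 2 ^ m.+2)%N := expn_split 2 lt_mt.
have tau_gt0 : 0 < (K%:R ^+ 2 / 2 : R) by rewrite divr_gt0 // exprn_gt0 // ltr0n.
have x_K : x <= K%:R * (B * ln x).
  apply: le_trans (_ : K%:R * (2 ^+ m.+2 * w%:R) <= _);
    last by rewrite ler_wpM2l.
  by rewrite mulrA -natrX -!natrM -KE ler_nat ltnW.
move=> le_delta; apply: le_trans (expected_queries_ge (ltW p_gt0)
  (ltW p_lt1) delta_gt0 tau_gt0 _ le_delta).
  rewrite lee_fin -mulrA ler_pM2l ?divr_gt0 // mulrAC ler_pM2r ?invr_gt0 //.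
  have -> : B ^- 2 * (x ^+ 2 / ln x ^+ 2) = (x / (B * ln x)) ^+ 2.
    by field; rewrite !gt_eqF.
  have xB : x / (B * ln x) <= K%:R by rewrite ler_pdivrMr // mulr_gt0.
  rewrite ler_sqr ?nnegrE ?ler0n //.
  by apply: divr_ge0; [|apply: mulr_ge0]; apply: ltW.
move=> s; have [leQ|ltQ] := leqP (2 * #|query A s|) (K ^ 2).
  rewrite ler_wpDr ?mulr_ge0 ?invr_ge0 ?(ltW tau_gt0) //; apply: le_trans le_m.
  apply: (@dyadic_success_le R p O n w _ p_gt0 p_lt1 isT good good_gap
    (query A s) (output A s) t m) => //.
  move=> i lt_it; have le_i : (2 ^ i.+1 <= n)%N.
    by apply: leq_trans le_tn; rewrite (leq_trans
      (leq_pexp2l _ lt_it)) // leq_pmulr.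
  have i_ge1 : 1 <= (2 ^ i.+1)%:R :> R by rewrite ler1n expn_gt0.
  split; last exact: leaf_number_power.
  by rewrite ltnS leaf_number_le ?ler_nat // (lt_le_trans _ i_ge1).
(* With more than [K ^ 2 / 2] queries, the trivial bound 1 on success is already below the query
   term. *)
apply: (@le_trans _ _ 1).
  rewrite -[leRHS](subset_mean1 p (edges (hard_graph p n))) big_mkcondr.
  apply: ler_sum => H _; rewrite mulr1; case: ifP => // _.
  by rewrite subset_prob_ge0 // ltW.
rewrite ler_wpDl ?divr_ge0 ?(ltW delta_gt0) //.
rewrite mulrC ler_pdivlMr // mul1r ler_pdivrMr // mulrC -natrX -natrM ler_nat.
exact: ltnW.
Qed.

Theorem theorem7p1 (R : realType) (p : R) (hp0 : 0 < p) (hp1 : p < 1) :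
  exists G : forall n : nat, sgraph 'I_n,
    (forall n : nat, bipartite (G n)) /\
    forall delta : R, 0 < delta ->
    exists c : R, 0 < c /\
    exists N : nat, forall n : nat, (N <= n)%N ->
    forall (d : measure_display) (T : measurableType d) (P : probability T R),
      (forall A : algorithm T (G n) {set 'I_n},
         (delta%:E <= success_prob P p (@minimum_vertex_cover 'I_n) A)%E ->
         ((c * (n%:R ^+ 2 / ln n%:R ^+ 2))%:E <= expected_queries P A)%E) /\
      (forall A : algorithm T (G n) {set {set 'I_n}},
         (delta%:E <= success_prob P p (@maximum_matching 'I_n) A)%E ->
         ((c * (n%:R ^+ 2 / ln n%:R ^+ 2))%:E <= expected_queries P A)%E).
Proof.
exists (hard_graph p); split=> [n|delta delta_gt0];
  first exact: dyadic_bipartite.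
have [c [c_gt0 [N queries]]] := hard_graph_queries hp0 hp1 delta_gt0.
exists c; split=> //; exists N => n le_Nn d T P; split.
  by apply: queries => // H H' C; apply: minimum_vertex_cover_local_gap.
by apply: queries => // H H' M; apply: maximum_matching_local_gap.
Qed.
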